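(* For every total Boolean function $f:\{0,1\}^n\to\{0,1\}$ and every $\epsilon\in[0,1/2)$, $\lambda(f)\le\frac{1}{1-2\epsilon}\,\widetilde{\deg}_\epsilon(f)$.
   Context: Here $\widetilde{\deg}_\epsilon(f)$ is the minimum degree of a real polynomial $q$ such that for all $x\in\{0,1\}^n$, $f(x)=1\Rightarrow q(x)\in[1-2\epsilon,1]$ and $f(x)=0\Rightarrow q(x)\in[-1,-1+2\epsilon]$. The sensitivity graph $G_f$ has vertex set $\{0,1\}^n$ and an edge between $x,y$ iff they differ in exactly one coordinate and $f(x)\ne f(y)$; $A_f$ is its adjacency matrix and $\lambda(f)=\|A_f\|$ (spectral norm). *)

(* Defs.v *)
From HB Require Import structures.
From mathcomp Require Import all_boot all_order all_algebra.
From mathcomp Require Import mpoly.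
From mathcomp Require Import boolp classical_sets reals.

Set Implicit Arguments.
Unset Strict Implicit.
Unset Printing Implicit Defensive.

Import Order.TTheory GRing.Theory Num.Theory.
Local Open Scope ring_scope.

Section BoolFun.
Variable R : realType.
Variable n : nat.

Definition cube := {ffun 'I_n -> bool}.

Definition cube_pt (x : cube) : 'I_n -> R := fun i => (x i)%:R.

Definition sens_adj (f : cube -> bool) (x y : cube) : R :=
  if (#|[set i | x i != y i]| == 1)%N && (f x != f y) then 1 else 0.

Definition l2norm (v : cube -> R) : R := Num.sqrt (\sum_x v x ^+ 2).

Definition matvec (A : cube -> cube -> R) (v : cube -> R) : cube -> R :=
  fun x => \sum_y A x y * v y.

Definition spec_norm (A : cube -> cube -> R) : R :=
  sup [set r | exists v : cube -> R, l2norm v = 1 /\ r = l2norm (matvec A v)].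

Definition sens_lambda (f : cube -> bool) : R := spec_norm (sens_adj f).

(* q epsilon-approximates f in the (+-1)-sense of the paper:
   f x = 1 -> q x in [1-2eps, 1];  f x = 0 -> q x in [-1, -1+2eps]. *)
Definition eps_approx (eps : R) (f : cube -> bool) (q : {mpoly R[n]}) : Prop :=
  forall x : cube,
    if f x then 1 - 2 * eps <= q.@[cube_pt x] <= 1
    else -1 <= q.@[cube_pt x] <= -1 + 2 * eps.

(* There is a real polynomial of (total) degree <= d eps-approximating f.
   (msize q = 1 + total degree of q, and msize 0 = 0.) *)
Definition has_approx_deg (eps : R) (f : cube -> bool) (d : nat) : bool :=
  `[< exists q : {mpoly R[n]}, (msize q <= d.+1)%N /\ eps_approx eps f q >].

(* The eps-approximate degree: the minimum such d.  (Such a d always exists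
   for eps >= 0, e.g. the exact multilinear interpolant; the fallback 0 is
   never used in that case.) *)
Definition approx_deg (eps : R) (f : cube -> bool) : nat :=
  match pselect (exists d, has_approx_deg eps f d) with
  | left h => ex_minn h
  | right _ => 0%N
  end.

End BoolFun.

(* Main.v *)
(* Let [q] approximate [f] with degree [d], [P = diag q] and [A] the adjacency
   matrix of the cube. On an edge [xy] the commutator [PA - AP] has entry
   [q x - q y]; restricted to rows in [f = 1] and columns in [f = 0] its support
   is exactly the set of sensitive edges, where it is at least [2 (1 - 2 eps)].
   So it suffices to bound the norm of [PA - AP] by [2 d].
   In the Walsh basis [A] is diagonal, and [P] has no entry between characters
   [a], [b] whose weights differ by more than [d]; the commutator multiplies the
   remaining entries by [2 (|a| - |b|)]. On [-d, d] the function [2 t] is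
   a correlation of two [+-1] square waves of period [4 d], which writes the
   commutator as a sum of [2 d] matrices [D P D'] with [D], [D'] diagonal sign
   matrices, each of norm at most [1]. *)
Require Import Defs.
From HB Require Import structures.
From mathcomp Require Import all_boot all_order all_algebra.
From mathcomp Require Import mpoly.
From mathcomp Require Import boolp classical_sets reals.
From mathcomp Require Import zify ring lra.
Import Order.TTheory GRing.Theory Num.Theory.
Local Open Scope ring_scope.

(** * Autocorrelation of a square wave *)

Section SquareWave.
Variable R : comNzRingType.

Definition square_wave (N i : nat) : R := (-1) ^+ (i %/ N).

(** Both factors change sign when [j] grows by [N], so their product has period [N] and every window
    of [N] consecutive indices gives the same sum. *)
Lemma square_wave_shift N a k :
  \sum_(j < N) square_wave N (j + a) * square_wave N (j + (a + k)) =
  \sum_(j < N) square_wave N j * square_wave N (j + k).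
Proof.
elim: a => [|a IHa]; first by apply: eq_bigr => j _; rewrite addn0.
case: N IHa => [|N] IHa; first by rewrite !big_ord0.
rewrite -{}IHa big_ord_recr [RHS]big_ord_recl /= addrC; congr (_ + _).
  have per b : square_wave N.+1 (N.+1 + b) = - square_wave N.+1 b.
    by rewrite /square_wave divnDl ?dvdnn // divnn exprS mulN1r.
  by rewrite !addSn -!addSnnS !per mulrNN !add0n.
by apply: eq_bigr => j _; rewrite /bump /= !add1n !addSn !addnS.
Qed.

(** For [j < N] the first factor is 1, and the second is -1 exactly on the last [k] indices. *)
Lemma square_wave_autocorr N k : (k <= N)%N ->
  \sum_(j < N) square_wave N j * square_wave N (j + k) = N%:R - 2 * k%:R.
Proof.
move=> le_kN.
have -> : \sum_(j < N) square_wave N j * square_wave N (j + k) =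
    \sum_(0 <= j < N) (if (j < N - k)%N then 1 else -1).
  rewrite big_mkord; apply: eq_bigr => j _.
  have N0 : (0 < N)%N by apply: leq_ltn_trans (ltn_ord j).
  rewrite /square_wave divn_small // mul1r ltn_subRL addnC.
  case: ltnP => jk; first by rewrite divn_small.
  rewrite -(subnK jk) divnDr // divnn N0 divn_small ?add0n ?expr1 //.
  have := ltn_ord j; lia.
rewrite (big_cat_nat (n := N - k)) ?leq_subr //=.
rewrite [X in X + _](eq_big_nat _ _ (F2 := fun=> 1)); last by move=> i /andP[_ ->].
rewrite [X in _ + X](eq_big_nat _ _ (F2 := fun=> -1)); last first.
  by move=> i /andP[+ _]; rewrite ltnNge => ->.
rewrite !sumr_const_nat subn0 subKn // natrB // mulNrn; ring.
Qed.

(* The triangle wave, which is linear on [-d, d], is the correlation of two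
   square waves of period 4d. *)
Lemma square_wave_linear d a b : (a <= b + d)%N -> (b <= a + d)%N ->
  \sum_(j < d.*2) square_wave d.*2 (j + a) * square_wave d.*2 (j + (b + d)) =
  2 * (a%:R - b%:R).
Proof.
(* The lag is [b + d - a]: the offset [d] keeps it between 0 and [d.*2] and makes the sum vanish at
   [a = b]. *)
move=> ab ba; rewrite -(subnKC ab) square_wave_shift square_wave_autocorr; last lia.
rewrite natrB // -muln2 natrM natrD; ring.
Qed.

End SquareWave.

(** * Walsh analysis on the cube and the commutator bound *)

Section Walsh.
Variables (R : realFieldType) (n : nat).
Implicit Types (a b x y : cube n) (u v p : cube n -> R).

Definition walsh a x : R := \prod_i (-1) ^+ (a i && x i).

(** The inverse Walsh transform without normalisation, hence the factor [2 ^+ n] in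
    [sqnorm_synth]. *)
Definition synth u x : R := \sum_a u a * walsh a x.

Definition sqnorm u : R := \sum_x u x ^+ 2.

Definition weight a : nat := \sum_i a i.

Definition flip (i : 'I_n) x : cube n := [ffun k => x k (+) (k == i)].

Lemma flipK i : involutive (flip i).
Proof. by move=> x; apply/ffunP => k; rewrite !ffunE -addbA addbb addbF. Qed.

Lemma walshC a x : walsh a x = walsh x a.
Proof. by apply: eq_bigr => i _; rewrite andbC. Qed.

Lemma sum_prod_cube (F : 'I_n -> bool -> R) :
  \sum_(x : cube n) \prod_i F i (x i) = \prod_i (F i true + F i false).
Proof.
rewrite -(bigA_distr_bigA F) /=.
by apply: eq_bigr => i _; rewrite big_bool.
Qed.

Lemma walsh_orth a b : \sum_x walsh a x * walsh b x = 2 ^+ n *+ (a == b).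
Proof.
transitivity (\prod_(i < n) (2 *+ (a i == b i) : R)).
  under eq_bigr do rewrite -big_split /=.
  rewrite (sum_prod_cube (fun i c => (-1) ^+ (a i && c) * (-1) ^+ (b i && c))).
  by apply: eq_bigr => i _; case: (a i) (b i) => [] [] /=; ring.
have [->|/eqP ab] := eqVneq a b.
  by under eq_bigr do rewrite eqxx; rewrite prodr_const card_ord.
case: (pickP (fun i => a i != b i)) => [i /negPf abi|abE].
  by rewrite (bigD1 i) //= abi mulr0n mul0r.
by case: ab; apply/ffunP => i; apply/eqP/negPn; rewrite abE.
Qed.

Lemma synth_onto u : exists v, u =1 synth v.
Proof.
have two0 : 2 ^+ n != 0 :> R by rewrite expf_neq0 ?pnatr_eq0.
exists (fun a => (2 ^+ n)^-1 * \sum_y u y * walsh a y) => x.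
rewrite /synth; under eq_bigr do rewrite -mulrA mulr_suml.
rewrite -mulr_sumr exchange_big /=.
under eq_bigr => y _.
  under eq_bigr => a _ do rewrite -mulrA walshC (walshC a).
  rewrite -mulr_sumr walsh_orth.
  over.
rewrite (bigD1 x) //= eqxx big1 ?addr0 => [|y /negPf->]; last by rewrite mulr0n mulr0.
by rewrite mulr1n mulrCA mulVf ?mulr1.
Qed.

Lemma synth_pairing u v p :
  \sum_x synth u x * p x * synth v x =
  \sum_a \sum_b u a * v b * \sum_x walsh a x * p x * walsh b x.
Proof.
rewrite /synth; under eq_bigr => x _.
  rewrite -mulrA mulr_suml; under eq_bigr do rewrite !mulr_sumr.
  over.
rewrite exchange_big; apply: eq_bigr => a _ /=.
rewrite exchange_big; apply: eq_bigr => b _ /=.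
by rewrite mulr_sumr; apply: eq_bigr => x _; ring.
Qed.

Lemma sqnorm_synth u : sqnorm (synth u) = 2 ^+ n * sqnorm u.
Proof.
transitivity (\sum_x synth u x * 1 * synth u x).
  by apply: eq_bigr => x _; rewrite mulr1.
rewrite (synth_pairing u u (fun=> 1)) mulr_sumr; apply: eq_bigr => a _.
rewrite (bigD1 a) //= [X in _ + X]big1 => [|b ba].
  under eq_bigr do rewrite mulr1.
  by rewrite walsh_orth eqxx mulr1n addr0 mulrC.
under eq_bigr do rewrite mulr1.
by rewrite walsh_orth eq_sym (negPf ba) mulr0.
Qed.

Lemma walsh_flip a i x : walsh a (flip i x) = (-1) ^+ (a i) * walsh a x.
Proof.
rewrite /walsh (bigD1 i) //= [in RHS](bigD1 i) //= mulrA; congr (_ * _).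
  by rewrite ffunE eqxx; case: (a i) (x i) => [] [] //=; ring.
by apply: eq_bigr => k /negPf ki; rewrite ffunE ki addbF.
Qed.

Lemma synth_flip u i x :
  synth u (flip i x) = synth (fun a => (-1) ^+ (a i) * u a) x.
Proof. by apply: eq_bigr => a _; rewrite walsh_flip; ring. Qed.

Lemma sum_signs a : \sum_i (-1) ^+ (a i) = n%:R - 2 * (weight a)%:R :> R.
Proof.
have -> : n%:R = \sum_(i < n) 1 :> R by rewrite sumr_const card_ord.
rewrite natr_sum mulr_sumr -sumrB; apply: eq_bigr => i _.
by case: (a i) => /=; ring.
Qed.

(** The adjacency matrix is the sum of the flips, so by [walsh_flip] and [sum_signs] the character
    of [a] has eigenvalue [n - 2 |a|]; the factor is the difference of the eigenvalues of [b] and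
    [a]. *)
Lemma walsh_commutator u v p :
  \sum_x \sum_i synth u x * (p x - p (flip i x)) * synth v (flip i x) =
  \sum_a \sum_b u a * v b * (2 * ((weight a)%:R - (weight b)%:R)) *
     \sum_x walsh a x * p x * walsh b x.
Proof.
transitivity (\sum_i (\sum_x synth u x * p x * synth v (flip i x)
                      - \sum_x synth u (flip i x) * p x * synth v x)).
  rewrite exchange_big; apply: eq_bigr => i _ /=.
  rewrite [X in _ - X](reindex_inj (inv_inj (flipK i))) -sumrB /=.
  by apply: eq_bigr => x _; rewrite flipK; ring.
under eq_bigr => i _.
  under eq_bigr do rewrite synth_flip.
  under [X in _ - X]eq_bigr do rewrite synth_flip.
  rewrite !synth_pairing -sumrB; under eq_bigr do rewrite -sumrB.
  over.
rewrite exchange_big; apply: eq_bigr => a _ /=.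
rewrite exchange_big; apply: eq_bigr => b _ /=.
move: (\sum_x walsh a x * p x * walsh b x) => K.
transitivity (u a * v b * (\sum_i (-1) ^+ b i - \sum_i (-1) ^+ a i) * K).
  by rewrite -sumrB mulr_sumr mulr_suml; apply: eq_bigr => i _; ring.
by rewrite !sum_signs; ring.
Qed.

(** Pointwise, twice the gap is [(1 + p) (u - v)^2 + (1 - p) (u + v)^2]. *)
Lemma pairing_le u v p : (forall x, `|p x| <= 1) ->
  2 * (\sum_x u x * p x * v x) <= sqnorm u + sqnorm v.
Proof.
move=> p1; rewrite mulr_sumr -big_split; apply: ler_sum => x _ /=.
have := p1 x; rewrite ler_norml => /andP[p_ge p_le].
have : 0 <= (1 + p x) * (u x - v x) ^+ 2 by rewrite mulr_ge0 ?sqr_ge0; lra.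
have : 0 <= (1 - p x) * (u x + v x) ^+ 2 by rewrite mulr_ge0 ?sqr_ge0; lra.
lra.
Qed.

(* An operator form of Bernstein's inequality for trigonometric polynomials. *)
Lemma commutator_le d u v p : (forall x, `|p x| <= 1) ->
  (forall a b, (weight a + d < weight b)%N || (weight b + d < weight a)%N ->
     \sum_x walsh a x * p x * walsh b x = 0) ->
  \sum_x \sum_i u x * (p x - p (flip i x)) * v (flip i x) <=
  d%:R * (sqnorm u + sqnorm v).
Proof.
move=> p1 p_band.
have [u' uE] := synth_onto u; have [v' vE] := synth_onto v.
(* The signs of the two waves are absorbed into the Walsh coefficients, which leaves the norms
   unchanged. *)
pose U j a := square_wave R d.*2 (j + weight a) * u' a.
pose V j b := square_wave R d.*2 (j + (weight b + d)) * v' b.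
have sq1 i : square_wave R d.*2 i ^+ 2 = 1 by rewrite sqrr_sign.
have QU j : sqnorm (synth (U j)) = sqnorm u.
  transitivity (sqnorm (synth u')); last by apply: eq_bigr => x _; rewrite uE.
  rewrite !sqnorm_synth; congr (_ * _); apply: eq_bigr => a _.
  by rewrite exprMn sq1 mul1r.
have QV j : sqnorm (synth (V j)) = sqnorm v.
  transitivity (sqnorm (synth v')); last by apply: eq_bigr => x _; rewrite vE.
  rewrite !sqnorm_synth; congr (_ * _); apply: eq_bigr => a _.
  by rewrite exprMn sq1 mul1r.
have -> : \sum_x \sum_i u x * (p x - p (flip i x)) * v (flip i x) =
    \sum_(j < d.*2) \sum_x synth (U j) x * p x * synth (V j) x.
  under eq_bigr do under eq_bigr do rewrite uE vE.
  rewrite walsh_commutator.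
  under [RHS]eq_bigr do rewrite synth_pairing.
  rewrite [RHS]exchange_big; apply: eq_bigr => a _ /=.
  rewrite [RHS]exchange_big; apply: eq_bigr => b _ /=.
  have [far|near] := boolP
      ((weight a + d < weight b)%N || (weight b + d < weight a)%N).
    by rewrite p_band // mulr0 big1 // => j _; rewrite mulr0.
  rewrite -(square_wave_linear R d); try lia.
  move: (\sum_x walsh a x * p x * walsh b x) => K.
  rewrite mulr_sumr mulr_suml; apply: eq_bigr => j _.
  by rewrite /U /V; ring.
(* [pairing_le] bounds twice each of the [d.*2] terms, so the factors 2 cancel and [d] remains. *)
rewrite -(ler_pM2l (_ : 0 < 2 :> R)) // mulr_sumr.
apply: le_trans (ler_sum _ (fun j _ => pairing_le _ _ _ p1)) _.
under eq_bigr do rewrite QU QV.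
by rewrite sumr_const card_ord -muln2 mulrnA -[_ *+ 2]mulr_natl -[_ *+ d]mulr_natl.
Qed.

Lemma weight_sub_le a b (m : 'X_{1..n}) :
  (forall i, m i = 0%N -> a i = b i) -> (weight a <= weight b + mdeg m)%N.
Proof.
move=> abE; rewrite mdegE /weight -big_split; apply: leq_sum => i _ /=.
case: (m i) (abE i) => [->|k _] //; first by rewrite addn0.
by case: (a i) (b i) => [] []; rewrite ?addnS.
Qed.

(** Take one monomial [m]. If [a] and [b] differ at a variable absent from [m], summing over that
    coordinate gives 1 - 1 = 0. Otherwise they differ only on the support of [m], which has at most
    [d] indices, so their weights are too close. *)
Lemma meval_band d (q : {mpoly R[n]}) a b : (msize q <= d.+1)%N ->
  (weight a + d < weight b)%N || (weight b + d < weight a)%N ->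
  \sum_(x : cube n) walsh a x * q.@[fun i => (x i)%:R] * walsh b x = 0.
Proof.
move=> qd far; under eq_bigr do rewrite mevalE mulr_sumr mulr_suml.
rewrite exchange_big big_seq big1 //= => m mq.
have md : (mdeg m <= d)%N by rewrite -ltnS (leq_trans (msize_mdeg_lt mq)).
have [i /andP[/eqP mi abi]|abE] := pickP (fun i => (m i == 0%N) && (a i != b i)).
  transitivity (q@_m * \sum_(x : cube n) \prod_i ((-1) ^+ (a i && x i) * (x i)%:R ^+ m i *
                               (-1) ^+ (b i && x i))).
    rewrite mulr_sumr; apply: eq_bigr => x _; rewrite !big_split /= /walsh; ring.
  rewrite (sum_prod_cube (fun i c => (-1) ^+ (a i && c) * c%:R ^+ m i * (-1) ^+ (b i && c))).
  rewrite (bigD1 i) //= mi !expr0 !andbF !andbT.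
  by case: (a i) (b i) abi => [] [] //= _; ring.
have ab i : m i = 0%N -> a i = b i.
  by move=> mi; have := abE i; rewrite mi eqxx /= => /negbFE/eqP.
have := weight_sub_le a b m ab.
have := weight_sub_le b a m (fun i mi => esym (ab i mi)).
lia.
Qed.

Lemma sum_neighbours x (F : cube n -> R) :
  \sum_(y : cube n | #|[set i | x i != y i]| == 1%N) F y = \sum_i F (flip i x).
Proof.
have flip_inj : injective (flip^~ x).
  move=> i j /ffunP/(_ i); rewrite !ffunE eqxx addbT.
  by case: eqP => // _; rewrite addbF; case: (x i).
rewrite -(big_imset F (h := flip^~ x) (A := predT)) => [|i j _ _ /flip_inj //].
apply: eq_bigl => y; apply/cards1P/imsetP => [[i /setP iE]|[i _ ->]].
  exists i => //; apply/ffunP => k; have := iE k; rewrite !inE !ffunE => <-.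
  by case: (x k) (y k) => [] [].
exists i; apply/setP => k; rewrite !inE ffunE.
by case: (x k) (k == i) => [] [].
Qed.

End Walsh.

(** * From approximating polynomials to the sensitivity graph *)

Section ApproxDegree.
Variables (R : realType) (n : nat).
Implicit Types (f : cube n -> bool) (eps : R).

Lemma interpolation (g : cube n -> R) :
  exists q : {mpoly R[n]}, forall x, q.@[cube_pt R x] = g x.
Proof.
exists (\sum_(a : cube n) g a *: \prod_i (if a i then 'X_i else 1 - 'X_i)) => x.
rewrite raddf_sum /= (bigD1 x) //= [X in _ + X]big1 => [|a ax].
  rewrite addr0 mevalZ rmorph_prod big1 ?mulr1 // => i _ /=.
  by case: ifP => xi; rewrite ?mevalB ?meval1 mevalXU /cube_pt xi ?subr0.
case: (pickP (fun i => a i != x i)) => [i axi|axE]; last first.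
  case/eqP: ax; apply/ffunP => i; apply/eqP/negPn; by rewrite axE.
rewrite mevalZ rmorph_prod (bigD1 i) //=.
case: ifP axi => ai; rewrite ?mevalB ?meval1 mevalXU /cube_pt; case: (x i) => // _.
  by rewrite mul0r mulr0.
by rewrite subrr mul0r mulr0.
Qed.

Lemma approx_deg_attained eps f : 0 <= eps ->
  exists q : {mpoly R[n]}, (msize q <= (approx_deg eps f).+1)%N /\ eps_approx eps f q.
Proof.
move=> eps0; rewrite /approx_deg; case: pselect => [h|[]].
  by case: ex_minnP => d /asboolP.
(* As [0 <= eps], the exact interpolant with values 1 and -1 is admissible, which rules out the
   fallback value of [approx_deg]. *)
have [q qE] := interpolation (fun x => if f x then 1 else -1).
exists (msize q); apply/asboolP; exists q; split => // x.
by rewrite qE; case: (f x); apply/andP; split; lra.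
Qed.

Lemma sens_adjE f x (F : cube n -> R) :
  \sum_y sens_adj R f x y * F y = \sum_i (f x != f (flip n i x))%:R * F (flip n i x).
Proof.
rewrite -(sum_neighbours R n x (fun y => (f x != f y)%:R * F y)) [RHS]big_mkcond.
apply: eq_bigr => y _; rewrite /sens_adj.
by case: (_ == _) (_ != _) => [] [] //=; rewrite ?mul0r ?mul1r.
Qed.

Lemma sens_form_le f delta d (p u v : cube n -> R) : 0 < delta ->
  (forall x, `|p x| <= 1) ->
  (forall x, if f x then delta <= p x else p x <= - delta) ->
  (forall a b, (weight n a + d < weight n b)%N || (weight n b + d < weight n a)%N ->
     \sum_x walsh R n a x * p x * walsh R n b x = 0) ->
  2 * delta * (\sum_x u x * \sum_y sens_adj R f x y * v y) <=
  d%:R * (sqnorm R n u + sqnorm R n v).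
Proof.
move=> delta0 p1 pf p_band.
(* Absolute values make every edge term nonnegative, so the lower bound [2 * delta] on [p x - p y]
   can be applied edge by edge. *)
pose on (c : bool) (w : cube n -> R) x := if f x == c then `|w x| else 0.
have sq_on w : sqnorm R n w = sqnorm R n (on true w) + sqnorm R n (on false w).
  rewrite /sqnorm -big_split; apply: eq_bigr => x _; rewrite /on.
  by case: (f x) => /=; rewrite expr0n ?addr0 ?add0r ?real_normK ?num_real.
rewrite (sq_on u) (sq_on v).
have := commutator_le R n d (on true u) (on false v) p p1 p_band.
have := commutator_le R n d (on true v) (on false u) p p1 p_band.
(* A sensitive edge is met from either end: the first sum takes the rows with [f x] true, the
   second, once reversed by a flip, those with [f x] false. *)
suff : 2 * delta * (\sum_x u x * \sum_y sens_adj R f x y * v y) <=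
  \sum_x \sum_i on true u x * (p x - p (flip n i x)) * on false v (flip n i x) +
  \sum_x \sum_i on true v x * (p x - p (flip n i x)) * on false u (flip n i x).
  by nra.
have -> : \sum_x \sum_i on true v x * (p x - p (flip n i x)) * on false u (flip n i x) =
    \sum_x \sum_i on false u x * (p (flip n i x) - p x) * on true v (flip n i x).
  rewrite exchange_big [RHS]exchange_big; apply: eq_bigr => i _ /=.
  rewrite (reindex_inj (inv_inj (flipK n i))) /=.
  by apply: eq_bigr => x _; rewrite flipK; ring.
rewrite mulr_sumr -big_split; apply: ler_sum => x _ /=.
rewrite sens_adjE !mulr_sumr -big_split; apply: ler_sum => i _ /=.
set y := flip n i x; rewrite /on; have := pf x; have := pf y.
have : u x * v y <= `|u x| * `|v y| by rewrite -normrM ler_norm.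
have : 0 <= `|u x| * `|v y| by rewrite mulr_ge0.
case: (f x) (f y) => [] [] /=; rewrite ?mul0r ?mulr0 ?addr0 ?add0r ?mul1r //; nra.
Qed.

End ApproxDegree.

Theorem theorem4p12 (R : realType) (n : nat) (f : cube n -> bool) (eps : R) :
  0 <= eps -> eps < 1 / 2 ->
  sens_lambda R f <= (1 - 2 * eps)^-1 * (approx_deg eps f)%:R.
Proof.
move=> eps0 eps2; have delta0 : 0 < 1 - 2 * eps by lra.
have [q [qd qf]] := approx_deg_attained R n eps f eps0.
set d := approx_deg eps f in qd *.
have bound0 : 0 <= (1 - 2 * eps)^-1 * d%:R.
  by rewrite mulr_ge0 ?invr_ge0 ?ler0n // ltW.
rewrite /sens_lambda /spec_norm; set E := [set r | _]%classic.
(* By convention the supremum of the empty set is 0. *)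
have [->|/set0P E0] := eqVneq E set0; first by rewrite sup0.
apply: ge_sup => // r [v [v1 rE]].
have [->//|r0] := eqVneq r 0.
have rpos : 0 < r by rewrite lt_def r0 rE sqrtr_ge0.
have sqn w : sqnorm R n w = l2norm w ^+ 2.
  by rewrite sqr_sqrtr // sumr_ge0 // => x _; rewrite sqr_ge0.
have q1 x : `|q.@[cube_pt R x]| <= 1.
  by rewrite ler_norml; have := qf x; case: (f x) => /andP[? ?]; apply/andP; split; lra.
have qdelta x : if f x then 1 - 2 * eps <= q.@[cube_pt R x]
                else q.@[cube_pt R x] <= - (1 - 2 * eps).
  by have := qf x; case: (f x) => /andP[? ?]; lra.
(* Testing the form on the unit vectors [w / r] and [v] gives exactly [r], whence
   [2 (1 - 2 eps) r <= 2 d]. *)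
pose w := matvec (sens_adj R f) v.
have := sens_form_le R n f _ d _ (fun x => r^-1 * w x) v delta0 q1 qdelta
  (fun a b => meval_band R n d q a b qd).
have -> : sqnorm R n (fun x => r^-1 * w x) = 1.
  rewrite /sqnorm; under eq_bigr do rewrite exprMn.
  by rewrite -mulr_sumr -/(sqnorm R n w) sqn -rE exprVn mulVf // expf_neq0.
have -> : \sum_x r^-1 * w x * (\sum_y sens_adj R f x y * v y) = r.
  under eq_bigr do rewrite -mulrA -expr2.
  by rewrite -mulr_sumr -/(sqnorm R n w) sqn -rE expr2 mulKf.
rewrite sqn v1 ler_pdivlMl // => H; lra.
Qed.
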